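(* Let $f\colon L\to M$ be a localic map and consider the conditions: (a) $f$ is open; (b) $\mathrm{int}(f_{-1}[T])=f_{-1}[\mathrm{int}\,T]$ for every sublocale $T$ of $M$; (c) $\mathrm{cl}(f_{-1}[T])=f_{-1}[\mathrm{cl}\,T]$ for every sublocale $T$ of $M$. Then (a) $\Leftrightarrow$ (b) $\Rightarrow$ (c).
   Context: A locale (= frame) is a complete lattice $L$ with $(\bigvee A)\wedge b=\bigvee\{a\wedge b\mid a\in A\}$ for all $A\subseteq L$, $b\in L$; it has a Heyting operation $\to$ with $a\wedge b\le c\iff a\le b\to c$. A frame homomorphism preserves all joins and all finite meets (including $0$ and $1$). A localic map $f\colon L\to M$ is a right adjoint of a frame homomorphism $M\to L$. A sublocale of $L$ is a subset $S\subseteq L$ closed under arbitrary meets (including the empty meet $1$) such that $x\to s\in S$ for all $x\in L$, $s\in S$. For $a\in L$: $\mathfrak c(a)=\{x\in L\mid x\ge a\}$ (closed sublocale), $\mathfrak o(a)=\{x\in L\mid a\to x=x\}$ (open sublocale). For a subset $S\subseteq L$, $\mathrm{cl}\,S=\mathfrak c(\bigwedge S)$ and $\mathrm{int}\,S=\mathfrak o(\bigvee\{a\in L\mid \mathfrak o(a)\subseteq S\})$. For a localic map $f\colon L\to M$ and a sublocale $T$ of $M$, $f_{-1}[T]$ denotes the largest sublocale of $L$ contained in the set-theoretic preimage $f^{-1}[T]$ (which exists). $f$ is open if for every $a\in L$ the image $f[\mathfrak o(a)]$ is an open sublocale of $M$. *)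

(* Defs.v *)
From HB Require Import structures.
From mathcomp Require Import all_boot all_order.
From mathcomp Require Import boolp classical_sets.

Set Implicit Arguments.
Unset Strict Implicit.
Unset Printing Implicit Defensive.

Import Order.LTheory.

Local Open Scope classical_set_scope.
Local Open Scope order_scope.

(* The MathComp lattice hierarchy only has finite meets and joins, hence this
   extension of tbLatticeType. Nothing forces \bot != \top: the one-element
   locale is allowed. *)
#[key="L"]
HB.mixin Record TBLattice_isFrame d (L : Type) of Order.TBLattice d L := {
  bigjoin : set L -> L;
  bigjoin_ub : forall (A : set L) (a : L), A a -> a <= bigjoin A;
  bigjoin_lub : forall (A : set L) (b : L),
    (forall a, A a -> a <= b) -> bigjoin A <= b;
  meet_bigjoinl : forall (A : set L) (b : L),
    Order.meet (bigjoin A) b = bigjoin [set Order.meet a b | a in A]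
}.

#[short(type="frameType")]
HB.structure Definition Frame d :=
  { L of Order.TBLattice d L & TBLattice_isFrame d L }.

Section FrameOperations.
Context {d : Order.disp_t} {L : frameType d}.
Implicit Types (A S : set L) (a b c x s : L).

Definition bigmeet A : L := bigjoin (lbound A).

Definition himp a b : L := bigjoin [set x | Order.meet x a <= b].

Lemma bigmeet_lb A a : A a -> bigmeet A <= a.
Proof. by move=> Aa; apply: bigjoin_lub => b; apply. Qed.

Lemma bigmeet_glb A b : (forall a, A a -> b <= a) -> b <= bigmeet A.
Proof. by move=> Ab; apply: bigjoin_ub. Qed.

Lemma himpP a b c : (Order.meet a b <= c) = (a <= himp b c).
Proof.
apply/idP/idP => [abc|le_a]; first exact: bigjoin_ub.
apply: le_trans (leI2 le_a (lexx b)) _.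
by rewrite meet_bigjoinl; apply: bigjoin_lub => _ [x xbc <-].
Qed.

Definition sublocale S : Prop :=
  (forall A, A `<=` S -> S (bigmeet A)) /\ (forall x s, S s -> S (himp x s)).

Definition closed_sl a : set L := [set x | a <= x].

Definition open_sl a : set L := [set x | himp a x = x].

Definition cl_sl S : set L := closed_sl (bigmeet S).

Definition int_sl S : set L := open_sl (bigjoin [set a | open_sl a `<=` S]).

Definition largest_sublocale_in (P S : set L) : Prop :=
  [/\ sublocale S, S `<=` P &
      forall S', sublocale S' -> S' `<=` P -> S' `<=` S].

End FrameOperations.

Section LocalicMaps.
Context {dL dM : Order.disp_t} {L : frameType dL} {M : frameType dM}.

(* Preservation of the bottom element is the case A = set0 of the first
   clause. *)
Definition frame_hom (h : M -> L) : Prop :=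
  [/\ forall A : set M, h (bigjoin A) = bigjoin (h @` A),
      h \top = \top &
      forall a b : M, h (Order.meet a b) = Order.meet (h a) (h b)].

Definition localic_map (f : L -> M) : Prop :=
  exists h : M -> L,
    frame_hom h /\ (forall (y : M) (x : L), (h y <= x) = (y <= f x)).

Definition open_localic (f : L -> M) : Prop :=
  forall a : L, exists b : M, f @` open_sl a = open_sl b.

(* The default set0 is never returned when f is a localic map and T is a
   sublocale, by preimage_slP. *)
Definition preimage_sl (f : L -> M) (T : set M) : set L :=
  xget set0 (largest_sublocale_in (f @^-1` T)).

Lemma preimage_slP (f : L -> M) (T : set M) :
  localic_map f -> sublocale T ->
  largest_sublocale_in (f @^-1` T) (preimage_sl f T).
Proof.
move=> [h [_ adj]] [Tmeet _]; apply: xgetPex.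
pose U : set L :=
  [set x | exists S, [/\ sublocale S, S `<=` f @^-1` T & S x]].
exists [set x | forall y, (forall u, U u -> x <= u -> y <= u) -> y <= x].
split.
- split=> [A AJ y yP|w x xJ y yP].
    apply: bigmeet_glb => a Aa; apply: (AJ a Aa) => u Uu le_au.
    by apply: yP => //; apply: le_trans le_au; apply: bigmeet_lb.
  rewrite -himpP; apply: xJ => u [S [[Sm Si] ST Su]] le_xu.
  rewrite himpP; apply: yP; first by exists S; split=> //; apply: Si.
  by rewrite -himpP; apply: le_trans le_xu; rewrite himpP.
- move=> x xJ /=.
  suff -> : f x = bigmeet [set f u | u in [set u | U u /\ x <= u]].
    by apply: Tmeet => _ [u [[S [_ ST Su]] _] <-]; apply: ST.
  apply/eqP; rewrite eq_le; apply/andP; split.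
    apply: bigmeet_glb => _ [u [_ le_xu] <-].
    by rewrite -adj; apply: le_trans le_xu; rewrite adj.
  rewrite -adj; apply: xJ => u Uu le_xu; rewrite adj.
  by apply: bigmeet_lb; exists u.
- move=> S subS ST x Sx y; apply=> //.
  by exists S.
Qed.

End LocalicMaps.

(* Main.v *)
Require Import Defs.
From mathcomp Require Import all_boot all_order.
From mathcomp Require Import boolp classical_sets.

(** Openness of [f], with left adjoint [h], enters through the formula
    [f (a -> h t) = b -> t], valid whenever [f[o(a)] = o(b)]. It shows that the
    sublocale [{x -> h t | x}] generated by [h t] is mapped into any sublocale
    containing [t], so that [h t] lies in [f_{-1}[T]] for every [t] in [T]. The
    same formula with [a] the meet of [f_{-1}[T]] then gives [a <= h (/\ T)],
    which is the nontrivial half of (c). *)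

Set Implicit Arguments.
Unset Strict Implicit.
Unset Printing Implicit Defensive.

Import Order.LTheory.

Local Open Scope classical_set_scope.
Local Open Scope order_scope.

Section FrameTheory.
Context {d : Order.disp_t} {L : frameType d}.
Implicit Types (A S : set L) (a b c x y s : L).

Lemma le_himp b c : c <= himp b c.
Proof. by rewrite -himpP leIl. Qed.

Lemma himp_mp a b c : a <= himp b c -> a <= b -> a <= c.
Proof. by rewrite -himpP => + ab; rewrite (meet_l ab). Qed.

Lemma himp_top b c : b <= c -> himp b c = \top.
Proof. by move=> bc; apply/eqP; rewrite -le1x -himpP meet1x. Qed.

Lemma himp_eq_top b c : himp b c = \top -> b <= c.
Proof. by move=> E; rewrite -[b]meet1x himpP E. Qed.

Lemma himp_mono a b c : b <= c -> himp a b <= himp a c.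
Proof. by move=> bc; rewrite -himpP; apply: le_trans bc; rewrite himpP. Qed.

Lemma himp_anti a b c : a <= b -> himp b c <= himp a c.
Proof.
by move=> ab; rewrite -himpP; apply: le_trans (leI2 (lexx _) ab) _; rewrite himpP.
Qed.

Lemma himp_himp a b c : himp a (himp b c) = himp (Order.meet a b) c.
Proof.
by apply/eqP; rewrite eq_le; apply/andP; split;
  [rewrite -himpP meetA !himpP | rewrite -!himpP -meetA himpP].
Qed.

Lemma himp_idem a x : himp a (himp a x) = himp a x.
Proof. by rewrite himp_himp meetxx. Qed.

Lemma himp_bigjoin A c : himp (bigjoin A) c = bigmeet [set himp a c | a in A].
Proof.
apply/eqP; rewrite eq_le; apply/andP; split.
  by apply: bigmeet_glb => _ [a Aa <-]; apply/himp_anti/bigjoin_ub.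
rewrite -himpP meetC meet_bigjoinl; apply: bigjoin_lub => _ [a Aa <-].
by rewrite meetC himpP; apply: bigmeet_lb; exists a.
Qed.

Lemma open_slP a x : himp a x <= x -> open_sl a x.
Proof. by move=> ax; apply/eqP; rewrite eq_le ax le_himp. Qed.

Lemma open_sl_sublocale a : sublocale (open_sl a).
Proof.
split=> [A Aa|x s as_]; last by rewrite /open_sl /= himp_himp meetC -himp_himp as_.
apply: open_slP; apply: bigmeet_glb => x Ax.
by rewrite -(Aa x Ax); apply/himp_mono/bigmeet_lb.
Qed.

Lemma closed_sl_sublocale a : sublocale (closed_sl a).
Proof.
split=> [A Aa|x s as_]; first by apply: bigmeet_glb => x /Aa.
exact: le_trans as_ (le_himp _ _).
Qed.

Lemma open_sl_mono a b : a <= b -> open_sl a `<=` open_sl b.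
Proof. by move=> ab x <-; apply: open_slP; rewrite himp_himp (meet_r ab). Qed.

(** By [himp_bigjoin], a member [x] of the interior is the meet of the elements [himp a x] with
    [open_sl a] inside [S]; each of them lies in [S]. *)
Lemma int_sl_sub S : sublocale S -> int_sl S `<=` S.
Proof.
move=> [Sm _] x <-; rewrite himp_bigjoin; apply: Sm => _ [a aS <-].
by apply: aS; apply: himp_idem.
Qed.

Lemma open_sub_int a S : open_sl a `<=` S -> open_sl a `<=` int_sl S.
Proof. by move=> aS; apply/open_sl_mono/bigjoin_ub. Qed.

Lemma himp_range_sublocale c : sublocale [set himp x c | x in setT].
Proof.
split=> [A AE|x _ [y _ <-]]; last by exists (Order.meet x y); rewrite ?himp_himp.
(* Implication into [c] turns joins into meets, so the join of all exponents occurring in [A] is the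
   witness. *)
exists (bigjoin [set x | A (himp x c)]) => //; rewrite himp_bigjoin.
congr bigmeet; apply/seteqP; split=> [_ [x Ax <-] //|y Ay].
by have [x _ xy] := AE y Ay; exists x => //=; rewrite xy.
Qed.

End FrameTheory.

Section LocalicMapTheory.
Context {dL dM : Order.disp_t} {L : frameType dL} {M : frameType dM}.
Context {f : L -> M} {h : M -> L}.
Hypothesis h_hom : frame_hom h.
Hypothesis adj : forall (y : M) (x : L), (h y <= x) = (y <= f x).

Let hf : localic_map f.
Proof. by exists h. Qed.

Lemma localic_bigmeet (A : set L) : f (bigmeet A) = bigmeet (f @` A).
Proof.
apply/eqP; rewrite eq_le; apply/andP; split.
  apply: bigmeet_glb => _ [x Ax <-].
  by rewrite -adj; apply: le_trans (bigmeet_lb Ax); rewrite adj.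
rewrite -adj; apply: bigmeet_glb => x Ax.
by rewrite adj; apply: bigmeet_lb; exists x.
Qed.

Lemma localic_himp (y : M) (x : L) : f (himp (h y) x) = himp y (f x).
Proof.
have [_ _ hI] := h_hom.
by apply/eqP; rewrite eq_le; apply/andP; split;
  [rewrite -himpP -adj hI himpP adj | rewrite -adj -himpP -hI adj himpP].
Qed.

(** Lets an inequality [a <= c] in [L] be tested in [M], as [f (himp a c) = \top]. *)
Lemma localic_eq_top (x : L) : f x = \top -> x = \top.
Proof.
have [_ h1 _] := h_hom.
by move=> fx; apply/eqP; rewrite -le1x -h1 adj fx.
Qed.

Lemma image_sublocale (S : set L) : sublocale S -> sublocale (f @` S).
Proof.
move=> [Sm Si]; split=> [A AfS|y _ [s Ss <-]]; last first.
  by exists (himp (h y) s); [apply: Si | apply: localic_himp].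
exists (bigmeet (S `&` f @^-1` A)); first by apply: Sm => x [].
rewrite localic_bigmeet; congr bigmeet; apply/seteqP.
by split=> [_ [x [_ Ax] <-] //|y Ay]; have [x Sx xy] := AfS y Ay;
  exists x => //; split=> //=; rewrite xy.
Qed.

(** For [x] in the preimage, [y := himp (himp (h b) x) x] is there too, so [f y = himp b (f y)]. As
    [h b <= y], this is [\top]; hence [y = \top], that is, [himp (h b) x <= x]. *)
Lemma preimage_open_sub (b : M) : preimage_sl f (open_sl b) `<=` open_sl (h b).
Proof.
have [[_ Si] Sb _] := preimage_slP hf (open_sl_sublocale b).
move=> x Sx; apply: open_slP; apply: himp_eq_top.
apply: localic_eq_top.
rewrite -(Sb _ (Si _ _ Sx)); apply: himp_top.
by rewrite -adj -himpP meetC himpP.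
Qed.

Lemma open_sub_preimage (b : M) : open_sl (h b) `<=` f @^-1` open_sl b.
Proof. by move=> x bx; rewrite /open_sl /= -localic_himp bx. Qed.

Lemma preimage_closed (b : M) :
  preimage_sl f (closed_sl b) = closed_sl (h b).
Proof.
have [_ Sb Smax] := preimage_slP hf (closed_sl_sublocale b).
apply/seteqP; split=> [x /Sb|]; first by rewrite /closed_sl /= adj.
by apply: Smax; [apply: closed_sl_sublocale|move=> x; rewrite /closed_sl /= adj].
Qed.

(** With [b] the join defining [int_sl T], the preimage of [open_sl b] lies in [open_sl (h b)], an
    open sublocale that [f] maps into [T]. *)
Lemma preimage_int_sub (T : set M) : sublocale T ->
  preimage_sl f (int_sl T) `<=` int_sl (preimage_sl f T).
Proof.
move=> subT; apply: subset_trans (@preimage_open_sub _) _; apply: open_sub_int.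
have [_ _ Tmax] := preimage_slP hf subT.
apply: Tmax; first exact: open_sl_sublocale.
move=> x /open_sub_preimage; exact: int_sl_sub.
Qed.

Lemma open_int_preimage (T : set M) : open_localic f -> sublocale T ->
  int_sl (preimage_sl f T) = preimage_sl f (int_sl T).
Proof.
move=> fo subT; apply/seteqP; split; last exact: preimage_int_sub.
have [subP PT _] := preimage_slP hf subT.
have [_ _ Imax] := preimage_slP hf (open_sl_sublocale _ : sublocale (int_sl T)).
apply: Imax; first exact: open_sl_sublocale.
(* [open_sl a] is the interior of the preimage; its image is open and inside [T], hence inside
   [int_sl T]. *)
rewrite /int_sl; set a := bigjoin _; have [b fab] := fo a.
have bT : open_sl b `<=` T.
  by rewrite -fab => _ [x ax <-]; apply: PT; apply: int_sl_sub ax.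
by move=> x ax; apply: (open_sub_int bT); rewrite -fab; exists x.
Qed.

(** The equation is applied to the image of [open_sl a]. The preimage of that image contains
    [open_sl a], hence so does its interior, and the equation puts the image inside its own
    interior. *)
Lemma int_preimage_open :
  (forall T : set M, sublocale T ->
     int_sl (preimage_sl f T) = preimage_sl f (int_sl T)) ->
  open_localic f.
Proof.
move=> fint a; set T := f @` open_sl a.
have subT : sublocale T by apply/image_sublocale/open_sl_sublocale.
exists (bigjoin [set b | open_sl b `<=` T]); apply/seteqP.
split; last exact: int_sl_sub.
have [_ _ Tmax] := preimage_slP hf subT.
have [_ IT _] := preimage_slP hf (open_sl_sublocale _ : sublocale (int_sl T)).
move=> _ [x ax <-]; apply: IT; rewrite -fint //.
apply: open_sub_int ax; apply: Tmax; first exact: open_sl_sublocale.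
by move=> y ay; exists y.
Qed.

(* [b] is the value at [a] of the left adjoint of [h], so this is the Frobenius
   reciprocity law in adjoint form. *)
Lemma open_frobenius (a : L) (b t : M) : f @` open_sl a = open_sl b ->
  f (himp a (h t)) = himp b t.
Proof.
move=> fab; apply/eqP; rewrite eq_le; apply/andP; split.
  (* [himp b t] lies in [open_sl b], so it is [f w] with [himp a w = w]; then [h t <= w] yields
     [himp a (h t) <= w]. *)
  have [w aw fw] : (f @` open_sl a) (himp b t) by rewrite fab; apply: himp_idem.
  have tw : h t <= w by rewrite adj fw le_himp.
  by rewrite -fw -adj -aw; apply: le_trans (himp_mono a tw); rewrite adj.
have <- : himp b (f (himp a (h t))) = f (himp a (h t)).
  suff : open_sl b (f (himp a (h t))) by [].
  by rewrite -fab; exists (himp a (h t)) => //; apply: himp_idem.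
by apply: himp_mono; rewrite -adj le_himp.
Qed.

Lemma open_preimage_mem (T : set M) (t : M) : open_localic f -> sublocale T ->
  T t -> preimage_sl f T (h t).
Proof.
move=> fo subT Tt; have [_ _ Tmax] := preimage_slP hf subT.
apply: (Tmax _ (himp_range_sublocale (h t))).
  move=> _ [x _ <-] /=; have [b /open_frobenius ->] := fo x.
  by have [_ Ti] := subT; apply: Ti.
exists \top => //; apply/eqP; rewrite eq_le le_himp andbT.
by apply: himp_mp (lexx _) (lex1 _).
Qed.

Lemma open_cl_preimage (T : set M) : open_localic f -> sublocale T ->
  cl_sl (preimage_sl f T) = preimage_sl f (cl_sl T).
Proof.
move=> fo subT; rewrite preimage_closed /cl_sl; congr closed_sl.
have [_ PT _] := preimage_slP hf subT.
apply/eqP; rewrite eq_le; apply/andP; split; last first.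
  by apply: bigmeet_glb => x Px; rewrite adj; apply/bigmeet_lb/PT.
set m := bigmeet (preimage_sl f T); have [b fmb] := fo m.
have f1 : f \top = \top by apply/eqP; rewrite -le1x -adj lex1.
(* The goal [m <= h (bigmeet T)] becomes [himp b (bigmeet T) = \top], that is, [b <= t] for all [t]
   in [T]. This holds because [m <= h t] gives [himp b t = f (himp m (h t)) = f \top = \top]. *)
apply: himp_eq_top; apply: localic_eq_top.
rewrite (open_frobenius _ fmb); apply: himp_top; apply: bigmeet_glb => t Tt.
apply: himp_eq_top; rewrite -(open_frobenius _ fmb) himp_top //.
exact/bigmeet_lb/open_preimage_mem.
Qed.

End LocalicMapTheory.

Theorem corollary5p2 (dL dM : Order.disp_t) (L : frameType dL)
    (M : frameType dM) (f : L -> M) (hf : localic_map f) :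
  (open_localic f <->
   (forall T : set M, sublocale T ->
      int_sl (preimage_sl f T) = preimage_sl f (int_sl T))) /\
  ((forall T : set M, sublocale T ->
      int_sl (preimage_sl f T) = preimage_sl f (int_sl T)) ->
   (forall T : set M, sublocale T ->
      cl_sl (preimage_sl f T) = preimage_sl f (cl_sl T))).
Proof.
have [h [h_hom adj]] := hf; split; first split.
- by move=> fo T; apply: (open_int_preimage h_hom adj).
- exact: (int_preimage_open h_hom adj).
- move=> /(int_preimage_open h_hom adj) fo T.
  exact: (open_cl_preimage h_hom adj).
Qed.
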